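(* Let $S$ be an integral domain which is not a field, let $F$ be its field of fractions, and let $A \neq F$ be an $F$-algebra. Let $I$ be a proper ideal of $A$. Assume that there exists a basis of $I$ over $F$ that is contained in some $S$-stable basis of $A$ over $F$. Then there exists an $S$-nice subalgebra $R$ of $A$ such that $I \triangleleft R$ (i.e. $I$ is contained in $R$ and is an ideal of $R$).
   Context: Algebras are associative, unital and nonzero, not necessarily commutative, and $A$ may be infinite dimensional over $F$; $F$ is identified with $F\cdot 1_A \subseteq A$. Ideals are two-sided. A basis $B$ of $A$ over $F$ is called $S$-stable if there exists a basis $C$ of $A$ over $F$ such that for all $c \in C$ and $b \in B$ one has $cb \in \sum_{y \in B} Sy$. An $S$-subalgebra $R$ of $A$ is called an $S$-nice subalgebra of $A$ if $R \cap F = S$ and $RF = A$, where $RF$ is the $F$-subspace of $A$ spanned by $R$. *)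

(* Defs.v *)
From HB Require Import structures.
From mathcomp Require Import all_boot all_order all_algebra.
From mathcomp Require Import all_classical.

Set Implicit Arguments.
Unset Strict Implicit.
Unset Printing Implicit Defensive.

Import GRing.Theory.

Local Open Scope classical_set_scope.
Local Open Scope ring_scope.

(* Possibly infinite families in a module of arbitrary dimension are sets
   [B : set V]; a linear combination always has finite support, given by a
   sequence of elements of [B].  Scalars are restricted to the set [K], so that
   the same notion covers F-spans ([K = setT]) and S-spans ([K] = image of S). *)
Definition lin_span (F : fieldType) (V : lmodType F) (K : set F) (B : set V)
    : set V :=
  [set x | exists (s : seq V) (c : V -> F),
     [/\ forall y, y \in s -> B y,
         forall y, y \in s -> K (c y)
       & x = \sum_(y <- s) c y *: y]].

Definition lin_indep (F : fieldType) (V : lmodType F) (B : set V) : Prop :=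
  forall (s : seq V) (c : V -> F),
    uniq s -> (forall y, y \in s -> B y) ->
    \sum_(y <- s) c y *: y = 0 -> forall y, y \in s -> c y = 0.

Definition is_basis (F : fieldType) (V : lmodType F) (U B : set V) : Prop :=
  lin_indep B /\ lin_span setT B = U.

Definition frac_int (S : idomainType) : set {fraction S} := range (@tofrac S).

Definition stable_basis (S : idomainType) (A : algType {fraction S})
    (B : set A) : Prop :=
  is_basis setT B /\
  exists C : set A, is_basis setT C /\
    forall c b, C c -> B b -> lin_span (@frac_int S) B (c * b).

Definition subalgebra (S : idomainType) (A : algType {fraction S})
    (R : set A) : Prop :=
  GRing.subring_closed [in R] /\
  forall (s : S) (x : A), R x -> R (tofrac s *: x).

(* F is identified with F 1_A, the range of [GRing.in_alg A]. *)
Definition nice_subalgebra (S : idomainType) (A : algType {fraction S})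
    (R : set A) : Prop :=
  [/\ subalgebra R,
      R `&` range (GRing.in_alg A) = GRing.in_alg A @` @frac_int S
    & lin_span setT R = setT].

Definition ideal_of (A : nzRingType) (R I : set A) : Prop :=
  [/\ I `<=` R,
      zmod_closed [in I]
    & forall r x, R r -> I x -> I (r * x) /\ I (x * r)].

(* Main.v *)
Require Import Defs.
From mathcomp Require Import all_boot all_order all_algebra.
From mathcomp Require Import all_classical.
Local Open Scope classical_set_scope.
Local Open Scope ring_scope.

(** Let [B] be the given stable basis and put [M = I + sum_(b in B) S b].  The
    ring is the left idealizer [R = {x | x M <= M}].  It contains [I], and it
    contains the basis [C] witnessing stability, so [RF = A].  If [a] in [F]
    lies in [R], choose [b] in [B] outside the basis of [I] (possible since [I]
    is proper); comparing the coefficients of [b] in [a b \in M] gives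
    [a \in S]. *)

Import GRing.Theory.

(** * Finite linear combinations with restricted coefficients *)

Section LinearSpans.
Variables (F : fieldType) (V : lmodType F).
Implicit Types (K : set F) (B : set V) (s u : seq V).

(** A sequence witnessing [lin_span] may repeat elements, while [lin_indep] needs [uniq].
    Repetitions are absorbed into the coefficients as multiplicities, which vanish outside [s]. *)
Lemma sum_count_uniq s u (c : V -> F) : uniq u -> {subset s <= u} ->
  \sum_(y <- s) c y *: y = \sum_(y <- u) (c y *+ count_mem y s) *: y.
Proof.
move=> uu; elim: s => [|x s IH] su.
  by rewrite big_nil big1 // => y _; rewrite mulr0n scale0r.
rewrite big_cons IH; last by move=> y ys; apply: su; rewrite inE ys orbT.
have xu : x \in u by apply: su; rewrite mem_head.
rewrite (bigD1_seq x) //= [RHS](bigD1_seq x) //= eqxx addrA -scalerDl -mulrS.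
by congr (_ + _); apply: eq_bigr => y; rewrite eq_sym => /negPf ->.
Qed.

Lemma lin_span_mem K B y : K 1 -> B y -> lin_span K B y.
Proof.
move=> K1 By; exists [:: y], (fun=> 1); split.
- by move=> z; rewrite inE => /eqP ->.
- by [].
- by rewrite big_seq1 scale1r.
Qed.

Lemma lin_spanS K B1 B2 : B1 `<=` B2 -> lin_span K B1 `<=` lin_span K B2.
Proof.
by move=> sB x [s [c [sB1 cK ->]]]; exists s, c; split=> // y /sB1 /sB.
Qed.

Lemma lin_spanZ K B k x : (forall a, K a -> K (k * a)) ->
  lin_span K B x -> lin_span K B (k *: x).
Proof.
move=> kK [s [c [sB cK ->]]]; exists s, (fun y => k * c y); split=> //.
  by move=> y /cK /kK.
by rewrite scaler_sumr; apply: eq_bigr => y _; rewrite scalerA.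
Qed.

Lemma lin_span0 K B : lin_span K B 0.
Proof. by exists [::], (fun=> 0); split=> //; rewrite big_nil. Qed.

Section AdditiveCoefficients.
Variable K : set F.
Hypothesis K0 : K 0.
Hypothesis KD : forall a b, K a -> K b -> K (a + b).

(** Nothing is known about [c] off [s], but there the multiplicity is zero and [K 0] suffices. *)
Lemma coef_count_mem s (c : V -> F) y :
  (forall z, z \in s -> K (c z)) -> K (c y *+ count_mem y s).
Proof.
move=> cK; have [ys|/count_memPn ->] := boolP (y \in s); last by rewrite mulr0n.
elim: (count_mem y s) => [|n IH]; first by rewrite mulr0n.
by rewrite mulrS; apply: KD => //; apply: cK.
Qed.

Lemma lin_spanD B x y :
  lin_span K B x -> lin_span K B y -> lin_span K B (x + y).
Proof.
move=> [s [c [sB cK ->]]] [t [d [tB dK ->]]].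
(* One coefficient function must serve both summands, so both are rewritten over the union of their
   supports. *)
exists (undup (s ++ t)),
  (fun z => c z *+ count_mem z s + d z *+ count_mem z t); split.
- by move=> z; rewrite mem_undup mem_cat => /orP[/sB|/tB].
- by move=> z _; apply: KD; apply: coef_count_mem.
- have uu := undup_uniq (s ++ t).
  rewrite (sum_count_uniq s _ c uu); last first.
    by move=> z zs; rewrite mem_undup mem_cat zs.
  rewrite (sum_count_uniq t _ d uu); last first.
    by move=> z zt; rewrite mem_undup mem_cat zt orbT.
  by rewrite -big_split; apply: eq_bigr => z _; rewrite scalerDl.
Qed.

(** Since [b] lies outside [B1], [x] contributes nothing to the coefficient of [b]; hence [a] equals
    the coefficient of [b] in [y], which is in [K]. *)
Lemma lin_indep_coef B B1 b a x y : lin_indep B -> B b -> B1 `<=` B -> ~ B1 b ->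
  lin_span setT B1 x -> lin_span K B y -> a *: b = x + y -> K a.
Proof.
move=> indB Bb sB nB1b [s [c [sB1 _ ->]]] [t [d [tB dK ->]]] eab.
pose u := undup (b :: s ++ t).
have uu : uniq u by apply: undup_uniq.
have bu : b \in u by rewrite mem_undup mem_head.
(* [e] holds the coefficients of the relation [a *: b - (x + y) = 0] over the common support [u]. *)
pose e z := a *+ count_mem z [:: b] -
  (c z *+ count_mem z s + d z *+ count_mem z t).
have /(_ b bu) : forall z, z \in u -> e z = 0.
  apply: (indB u e uu).
    move=> z; rewrite mem_undup inE mem_cat => /or3P[/eqP -> //|/sB1 /sB //|/tB //].
  have: a *: b - (\sum_(z <- s) c z *: z + \sum_(z <- t) d z *: z) = 0.
    by rewrite eab subrr.
  rewrite -(big_seq1 +%R b (fun z => a *: z)).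
  rewrite (sum_count_uniq [:: b] u (fun=> a) uu); last first.
    by move=> z; rewrite inE => /eqP ->.
  rewrite (sum_count_uniq s u c uu); last first.
    by move=> z zs; rewrite mem_undup inE mem_cat zs orbT.
  rewrite (sum_count_uniq t u d uu); last first.
    by move=> z zt; rewrite mem_undup inE mem_cat zt !orbT.
  rewrite -big_split -sumrB => sum0; rewrite -[RHS]sum0; apply: eq_bigr => z _.
  by rewrite scalerBl scalerDl.
have /count_memPn bs : b \notin s by apply/negP => /sB1.
rewrite /e bs mulr0n add0r /= eqxx mulr1n => /eqP; rewrite subr_eq0 => /eqP ->.
exact: coef_count_mem.
Qed.

End AdditiveCoefficients.
End LinearSpans.

(** * The image of $S$ in $F$ as a subring *)

Section FracInt.
Variable S : idomainType.

Lemma frac_int0 : @frac_int S 0.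
Proof. by exists 0; rewrite ?rmorph0. Qed.

Lemma frac_int1 : @frac_int S 1.
Proof. by exists 1; rewrite ?rmorph1. Qed.

Lemma frac_intD a b : @frac_int S a -> @frac_int S b -> @frac_int S (a + b).
Proof. by move=> [x _ <-] [y _ <-]; exists (x + y); rewrite ?rmorphD. Qed.

Lemma frac_intM a b : @frac_int S a -> @frac_int S b -> @frac_int S (a * b).
Proof. by move=> [x _ <-] [y _ <-]; exists (x * y); rewrite ?rmorphM. Qed.

Lemma frac_intN1 : @frac_int S (-1).
Proof. by exists (-1); rewrite ?rmorphN1. Qed.

End FracInt.

(** * The left idealizer of $M$ *)

Section Idealizer.
Variables (S : idomainType) (A : algType {fraction S}) (I B : set A).
Hypothesis idI : ideal_of setT I.

Let M : set A :=
  [set x | exists i t, [/\ I i, lin_span (@frac_int S) B t & x = i + t]].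

Definition idealizer : set A := [set x | forall m, M m -> M (x * m)].

Lemma ideal_of_0 : I 0.
Proof. by case: idI => _ [/set_mem]. Qed.

Lemma ideal_of_B x y : I x -> I y -> I (x - y).
Proof.
by case: idI => _ [_ IB] _ Ix Iy; apply/set_mem/IB; apply/mem_set.
Qed.

Lemma ideal_of_D x y : I x -> I y -> I (x + y).
Proof.
(* [zmod_closed] provides only zero and differences, so the sum is read as $x - (0 - y)$. *)
move=> Ix Iy; rewrite -[y]opprK; apply: ideal_of_B => //.
by rewrite -sub0r; apply: ideal_of_B => //; apply: ideal_of_0.
Qed.

Lemma ideal_of_Ml x y : I y -> I (x * y).
Proof. by case: idI => _ _ /(_ x y Logic.I) h /h[]. Qed.

Lemma ideal_of_Mr x y : I x -> I (x * y).
Proof. by case: idI => _ _ /(_ y x Logic.I) h /h[]. Qed.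

(** [ideal_of] does not mention scalars; scaling by [k] is multiplication by [k%:A]. *)
Lemma ideal_of_Z k x : I x -> I (k *: x).
Proof. by rewrite -mulr_algl; apply: ideal_of_Ml. Qed.

Lemma sub_idealM x : I x -> M x.
Proof. by exists x, 0; split=> //; [apply: lin_span0|rewrite addr0]. Qed.

Lemma sub_spanM x : lin_span (@frac_int S) B x -> M x.
Proof. by exists 0, x; split=> //; [apply: ideal_of_0|rewrite add0r]. Qed.

Lemma idealizerM_D x y : M x -> M y -> M (x + y).
Proof.
move=> [i [t [Ii Bt ->]]] [j [r [Ij Br ->]]]; exists (i + j), (t + r); split.
- exact: ideal_of_D.
- by apply: lin_spanD => //; [apply: frac_int0|apply: frac_intD].
- by rewrite addrACA.
Qed.

Lemma idealizerM_Z k x : @frac_int S k -> M x -> M (k *: x).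
Proof.
move=> Sk [i [t [Ii Bt ->]]]; exists (k *: i), (k *: t); split.
- exact: ideal_of_Z.
- by apply: lin_spanZ => // a; apply: frac_intM.
- by rewrite scalerDr.
Qed.

(** As $I$ absorbs multiplication on the right, $IM \subseteq I \subseteq M$. *)
Lemma sub_idealizer : I `<=` idealizer.
Proof. by move=> x Ix m _; apply/sub_idealM/ideal_of_Mr. Qed.

Lemma idealizer_alg k : @frac_int S k -> idealizer (k%:A).
Proof. by move=> Sk m Mm; rewrite mulr_algl; apply: idealizerM_Z. Qed.

Lemma idealizer_subalgebra : subalgebra idealizer.
Proof.
split; last first.
  move=> s x Rx m /Rx Mxm; rewrite -scalerAl; apply: idealizerM_Z => //.
  by exists s.
split=> [|x y|x y].
- by apply/mem_set => m; rewrite mul1r.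
- move=> /set_mem Rx /set_mem Ry; apply/mem_set => m Mm.
  rewrite mulrBl -scaleN1r; apply: idealizerM_D; first exact: Rx.
  by apply: idealizerM_Z; [apply: frac_intN1|apply: Ry].
- move=> /set_mem Rx /set_mem Ry; apply/mem_set => m Mm.
  by rewrite -mulrA; apply/Rx/Ry.
Qed.

(** Left multiplication by [c] keeps $I$ inside $I$, and it suffices to test the other summand of
    $M$ on the generators in [B], because $M$ is an $S$-module. *)
Lemma idealizer_stabilizer c :
  (forall b, B b -> lin_span (@frac_int S) B (c * b)) -> idealizer c.
Proof.
move=> cB _ [i [_ [Ii [s [d [sB dS ->]]] ->]]]; rewrite mulrDr.
apply: idealizerM_D; first by apply/sub_idealM/ideal_of_Ml.
rewrite mulr_sumr big_seq; apply: (big_ind M).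
- exact/sub_idealM/ideal_of_0.
- exact: idealizerM_D.
- move=> y ys; rewrite -scalerAr; apply: idealizerM_Z; first exact: dS.
  exact/sub_spanM/cB/sB.
Qed.

Lemma idealizer_scalar BI b k : lin_indep B -> is_basis I BI -> BI `<=` B ->
  B b -> ~ BI b -> idealizer (k%:A) -> @frac_int S k.
Proof.
move=> indB [_ spanBI] sB Bb nb Rk.
have /Rk [i [t [Ii Bt]]] : M b.
  by apply/sub_spanM/lin_span_mem => //; apply: frac_int1.
(* Here $kb = i + t$ with [i] in the $F$-span of [BI], so the coefficient of [b] comes from [t]
   alone. *)
rewrite mulr_algl; apply: lin_indep_coef indB Bb sB nb _ Bt.
- exact: frac_int0.
- exact: frac_intD.
- by rewrite spanBI.
Qed.

End Idealizer.

Theorem theorem3p15 (S : idomainType) (A : algType {fraction S}) (I : set A) :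
  ~ GRing.field_axiom S ->
  range (GRing.in_alg A) <> setT ->
  ideal_of setT I ->
  I <> setT ->
  (exists BI B : set A, [/\ is_basis I BI, stable_basis B & BI `<=` B]) ->
  exists R : set A, nice_subalgebra R /\ ideal_of R I.
Proof.
move=> _ _ idI nIT [BI [B [bBI [[indB spanB] [C [[_ spanC] CB]]] sB]]].
have [b Bb nb] : exists2 b, B b & ~ BI b.
  (* If [B] were contained in [BI], then $A$, the span of [B], would be contained in $I$. *)
  apply: contrapT => nex; apply: nIT; case: bBI => _ <-; rewrite -subTset -spanB.
  by apply: lin_spanS => b Bb; apply: contrapT => nb; apply: nex; exists b.
exists (idealizer S A I B); split; last first.
  case: (idI) => _ zI mI; split=> // [|r x _]; last exact: mI.
  exact: sub_idealizer.
split.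
- exact: idealizer_subalgebra.
- apply/seteqP; split=> [x [Rx [k _ kx]]|x [k Sk <-]].
    exists k => //; rewrite -kx in Rx.
    exact: (idealizer_scalar _ _ _ _ idI _ _ _ indB bBI sB Bb nb Rx).
  by split; [apply: idealizer_alg|exists k].
(* $RF = A$ because $R$ contains [C], which spans $A$. *)
- rewrite -subTset -spanC; apply: lin_spanS => c Cc.
  by apply: idealizer_stabilizer => // b' Bb'; apply: CB.
Qed.
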